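(* Let $d\geqslant 5$ be an odd integer and let $n$ be a positive integer with $n\equiv -1\pmod{d}$. Then, modulo $(1-aq^n)(a-q^n)$, $$\sum_{k=0}^{n-1}[2dk+1]\frac{(a^{d-1}q, a^{d-3}q,\ldots, a^2q;q^d)_k\,(a^{1-d}q, a^{3-d}q,\ldots, a^{-2}q;q^d)_k\, (q;q^d)_k}{(a^{d-2}q^d, a^{d-4}q^d,\ldots,aq^d;q^d)_k\,(a^{2-d}q^d, a^{4-d}q^d,\ldots,a^{-1}q^d;q^d)_k\, (q^d;q^d)_k}\, q^{\frac{d(d-3)k}{2}}\equiv 0.$$
   Context: Here $q$ and $a$ are independent indeterminates. Notation: $(x;q)_k=(1-x)(1-xq)\cdots(1-xq^{k-1})$ for $k\ge 1$, $(x;q)_0=1$, and $(x_1,\ldots,x_m;q)_k=(x_1;q)_k\cdots(x_m;q)_k$ (so $(x;q^d)_k=\prod_{i=0}^{k-1}(1-xq^{di})$). For an integer $m$, $[m]=\frac{1-q^m}{1-q}$. In each list the exponents of $a$ change in steps of $2$: the exponents of $a$ in the numerator are $\pm2,\pm4,\ldots,\pm(d-1)$ and $0$, and in the denominator they are $\pm1,\pm3,\ldots,\pm(d-2)$ and $0$. For a rational function $A(a,q)$ and a polynomial $P(a,q)$, $A\equiv 0$ modulo $P$ means that $A=PU/V$ with polynomials $U,V$ in $a,q$ (over $\mathbb{Q}$), where $V$ is relatively prime to $P$. *)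

(* Defs.v *)
From HB Require Import structures.
From mathcomp Require Import all_boot all_order all_algebra.

Set Implicit Arguments.
Unset Strict Implicit.
Unset Printing Implicit Defensive.

Import GRing.Theory.
Local Open Scope ring_scope.

Definition qpoch (R : pzRingType) (x q : R) (k : nat) : R :=
  \prod_(i < k) (1 - x * q ^+ i).

(* (x_1, ..., x_m; q)_k *)
Definition qpochs (R : pzRingType) (xs : seq R) (q : R) (k : nat) : R :=
  \prod_(x <- xs) qpoch x q k.

Definition qint (F : fieldType) (q : F) (m : int) : F :=
  (1 - q ^ m) / (1 - q).

(* The library's coprimep is coprimality up to nonzero scalars of the          *)
(* coefficient ring (pseudo-division); in Q[a, q] this is weaker than having   *)
(* only constant common divisors, hence this definition.                       *)
Definition relatively_prime (R : idomainType) (x y : R) : Prop :=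
  forall c x' y' : R, x = c * x' -> y = c * y' -> c \is a GRing.unit.

Definition frac_congr0 (R : idomainType) (P : R) (A : {fraction R}) : Prop :=
  exists U V : R,
    [/\ V != 0, relatively_prime V P & A = tofrac (P * U) / tofrac V].

(* Q[a, q] is encoded as Q[q][a]: the outer variable is a, the inner one q.    *)
Notation Qaq := {poly {poly rat}}.
Definition pa : Qaq := 'X.
Definition pq : Qaq := ('X)%:P.

Notation Qaq_frac := {fraction {poly {poly rat}}}.
Definition fa : Qaq_frac := tofrac pa.
Definition fq : Qaq_frac := tofrac pq.

(* For odd d, each of the four exponent lists d-1, d-3, ..., 2;                *)
(* 1-d, 3-d, ..., -2; d-2, d-4, ..., 1; 2-d, 4-d, ..., -1 has                  *)
(* d./2 = (d - 1) / 2 entries.                                                 *)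
Definition numerator (F : fieldType) (a q : F) (d k : nat) : F :=
  qpochs [seq a ^ (d%:Z - 1 - 2 * j%:Z) * q | j <- iota 0 d./2] (q ^+ d) k
  * qpochs [seq a ^ (1 - d%:Z + 2 * j%:Z) * q | j <- iota 0 d./2] (q ^+ d) k
  * qpoch q (q ^+ d) k.

Definition denominator (F : fieldType) (a q : F) (d k : nat) : F :=
  qpochs [seq a ^ (d%:Z - 2 - 2 * j%:Z) * q ^+ d | j <- iota 0 d./2] (q ^+ d) k
  * qpochs [seq a ^ (2 - d%:Z + 2 * j%:Z) * q ^+ d | j <- iota 0 d./2] (q ^+ d) k
  * qpoch (q ^+ d) (q ^+ d) k.

Definition qsum (F : fieldType) (a q : F) (d n : nat) : F :=
  \sum_(0 <= k < n)
    qint q (2 * d * k + 1)%N%:Z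
    * (numerator a q d k / denominator a q d k)
    * q ^+ ((d * (d - 3) * k) %/ 2).

(* Main.v *)
Require Import Defs.
From HB Require Import structures.
From mathcomp Require Import all_boot all_order all_algebra.
From mathcomp Require Import ring zify.

Import GRing.Theory.
Local Open Scope ring_scope.

Set Implicit Arguments.
Unset Strict Implicit.
Unset Printing Implicit Defensive.

(** The modulus has exactly two roots in the variable a over the field Q(q),
    namely q^n and q^(-n), so everything reduces to the vanishing of the sum at
    these two points, and by the symmetry a <-> 1/a ([qsumV]) to a = q^n.

    Write d = 2h + 1, n + 1 = d(s + 1) and p = q^d.  At a = q^n the exponents of
    q in the numerator and in the denominator match modulo d: the factor with
    a^(i+1) upstairs is the factor with a^i downstairs shifted by p^s
    ([den_base_shift]).  Since
        (y p^s; p)_k / (y; p)_k = (y p^k; p)_s / (y; p)_s,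
    each matched quotient is a polynomial of degree at most s in z = p^k.  One
    numerator factor, with a^(1-d), is left over; it equals (p^(-N); p)_k with
    N = (d-1)(s+1) - 1, and it stands over the remaining (p; p)_k
    ([summand_qbin_coef]).  The sum has thus become
        sum_k (p^(-N); p)_k / (p; p)_k * z * Q(z),
    where Q collects the 2h quotients, the factor 1 - q z^2 of [2dk+1] and the
    power z^(h-2) left from q^(d(d-3)k/2) = z^(h-1).  As h >= 2, the degree of Q
    is at most h + 2hs < N.  Such a sum is zero because the moments
        S_j = sum_k (p^(-N); p)_k / (p; p)_k * p^(jk)
    vanish for 1 <= j <= N ([qbin_moment_eq0]), a case of the q-binomial theorem
    that follows here from the recurrence
        (1 - p^j) S_j = (1 - p^(j-N)) S_(j+1).
    Hence [qsum_qXn_eq0].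

    To speak of the value at a = q^n or q^(-n) of a fraction in a and q, fractions
    are written as U / V with V nonzero at both points; this is a relation
    ([specializes]) compatible with the field operations.  If U / V vanishes at
    both points then, up to a power of the leading coefficient of the modulus,
    U is a multiple of it, because a remainder of degree at most 1 has no room
    for two roots; the same count of roots shows that V is relatively prime to
    the modulus ([specializes_congr0]). *)

(** * Specialization of fractions *)

Section Specialization.
Variables (R : idomainType) (K : fieldType) (I : Type) (phi : I -> {rmorphism R -> K}).
Implicit Types (x : {fraction R}) (y : I -> K).

(** The value of a fraction under a morphism that need not be injective is
    defined only for suitable denominators, hence a relation.  A family of
    morphisms is treated at once so that a single representation U / V serves
    for all of them: coprimality with a product of primes needs a denominator
    avoiding them simultaneously. *)
Definition specializes x y : Prop :=
  exists U V : R, [/\ forall i, phi i V != 0, x = tofrac U / tofrac V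
                    & forall i, y i = phi i U / phi i V].

(* With an empty family the denominators would be unconstrained. *)
Variable i0 : I.

Lemma admissible_neq0 (V : R) : (forall i, phi i V != 0) -> tofrac V != 0.
Proof.
by move=> /(_ i0); rewrite tofrac_eq0; apply: contraNneq => ->; rewrite rmorph0.
Qed.

Lemma eq_specializes x y y' : y =1 y' -> specializes x y -> specializes x y'.
Proof. by move=> e [U [V [? ? h]]]; exists U, V; split=> // i; rewrite -e. Qed.

Lemma specializes_tofrac U : specializes (tofrac U) (fun i => phi i U).
Proof.
by exists U, 1; split=> [i||i]; rewrite ?rmorph1 ?oner_eq0 ?divr1.
Qed.

Lemma specializes1 : specializes 1 (fun=> 1).
Proof.
rewrite -tofrac1; apply: eq_specializes (specializes_tofrac 1) => i.
exact: rmorph1.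
Qed.

Lemma specializesB x x' y y' : specializes x y -> specializes x' y' ->
  specializes (x - x') (fun i => y i - y' i).
Proof.
move=> [U [V [V0 -> hy]]] [U' [V' [V0' -> hy']]].
have VF := admissible_neq0 V0; have VF' := admissible_neq0 V0'.
exists (U * V' - U' * V), (V * V'); split=> [i||i].
- by rewrite rmorphM mulf_neq0.
- by rewrite -mulNr addf_div // mulNr tofracB !tofracM.
- by rewrite hy hy' -mulNr addf_div // mulNr rmorphB !rmorphM.
Qed.

Lemma specializes0 : specializes 0 (fun=> 0).
Proof.
rewrite -tofrac0; apply: eq_specializes (specializes_tofrac 0) => i.
exact: rmorph0.
Qed.

Lemma specializesD x x' y y' : specializes x y -> specializes x' y' ->
  specializes (x + x') (fun i => y i + y' i).
Proof.
move=> hx hx'; rewrite -[x']opprK -[- x']sub0r.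
apply: eq_specializes (specializesB hx (specializesB specializes0 hx')).
by move=> i; rewrite sub0r opprK.
Qed.

Lemma specializesM x x' y y' : specializes x y -> specializes x' y' ->
  specializes (x * x') (fun i => y i * y' i).
Proof.
move=> [U [V [V0 -> hy]]] [U' [V' [V0' -> hy']]].
exists (U * U'), (V * V'); split=> [i||i].
- by rewrite rmorphM mulf_neq0.
- by rewrite !tofracM mulf_div.
- by rewrite hy hy' !rmorphM mulf_div.
Qed.

Lemma specializesV x y : (forall i, y i != 0) -> specializes x y ->
  specializes x^-1 (fun i => (y i)^-1).
Proof.
move=> y0 [U [V [V0 -> hy]]]; exists V, U; split=> [i||i].
- by move: (y0 i); rewrite hy mulf_eq0 negb_or => /andP[].
- by rewrite invf_div.
- by rewrite hy invf_div.
Qed.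

Lemma specializes_div x x' y y' : (forall i, y' i != 0) ->
  specializes x y -> specializes x' y' ->
  specializes (x / x') (fun i => y i / y' i).
Proof. by move=> y0 hx hx'; apply: specializesM hx (specializesV y0 hx'). Qed.

Lemma specializesX x y m : specializes x y ->
  specializes (x ^+ m) (fun i => y i ^+ m).
Proof.
move=> hx; elim: m => [|m IHm]; first exact: specializes1.
by rewrite exprS; apply: eq_specializes (specializesM hx IHm) => i; rewrite exprS.
Qed.

Lemma specializesXz x y (m : int) : (forall i, y i != 0) -> specializes x y ->
  specializes (x ^ m) (fun i => y i ^ m).
Proof.
move=> y0 hx; case: m => m; first exact: specializesX.
apply: specializesV; last exact: specializesX.
by move=> i; rewrite expf_neq0.
Qed.

Lemma specializes_sum (J : Type) (r : seq J) (f : J -> {fraction R}) (g : J -> I -> K) :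
  (forall j, specializes (f j) (g j)) ->
  specializes (\sum_(j <- r) f j) (fun i => \sum_(j <- r) g j i).
Proof.
move=> hfg; elim: r => [|j r IHr].
  by rewrite big_nil; apply: eq_specializes specializes0 => i; rewrite big_nil.
rewrite big_cons; apply: eq_specializes (specializesD (hfg j) IHr) => i.
by rewrite big_cons.
Qed.

Lemma specializes_prod (J : Type) (r : seq J) (f : J -> {fraction R}) (g : J -> I -> K) :
  (forall j, specializes (f j) (g j)) ->
  specializes (\prod_(j <- r) f j) (fun i => \prod_(j <- r) g j i).
Proof.
move=> hfg; elim: r => [|j r IHr].
  by rewrite big_nil; apply: eq_specializes specializes1 => i; rewrite big_nil.
rewrite big_cons; apply: eq_specializes (specializesM (hfg j) IHr) => i.
by rewrite big_cons.
Qed.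

Lemma specializes_qpoch x q y c k : specializes x y -> specializes q c ->
  specializes (qpoch x q k) (fun i => qpoch (y i) (c i) k).
Proof.
move=> hx hq.
apply: (specializes_prod (index_enum _) (f := fun j : 'I_k => 1 - x * q ^+ j)
  (g := fun (j : 'I_k) i => 1 - y i * c i ^+ j)) => j.
exact: specializesB specializes1 (specializesM hx (specializesX j hq)).
Qed.

Lemma specializes_qpochs (J : Type) (r : seq J)
    (f : J -> {fraction R}) (g : J -> I -> K) q c k :
  (forall j, specializes (f j) (g j)) -> specializes q c ->
  specializes (qpochs [seq f j | j <- r] q k)
              (fun i => qpochs [seq g j i | j <- r] (c i) k).
Proof.
move=> hfg hq; rewrite /qpochs big_map.
have /eq_specializes := specializes_prod r (fun j => specializes_qpoch k (hfg j) hq).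
by apply=> i; rewrite big_map.
Qed.

Lemma specializes_numerator x q y c d k : (forall i, y i != 0) ->
  specializes x y -> specializes q c ->
  specializes (numerator x q d k) (fun i => numerator (y i) (c i) d k).
Proof.
move=> y0 hx hq; have hqd := specializesX d hq.
have hfactor (e : nat -> int) j := specializesM (specializesXz (e j) y0 hx) hq.
apply: specializesM (specializes_qpoch k hq hqd).
apply: specializesM.
  exact: (specializes_qpochs _ _ (hfactor (fun j => d%:Z - 1 - 2 * j%:Z)) hqd).
exact: (specializes_qpochs _ _ (hfactor (fun j => 1 - d%:Z + 2 * j%:Z)) hqd).
Qed.

Lemma specializes_denominator x q y c d k : (forall i, y i != 0) ->
  specializes x y -> specializes q c ->
  specializes (denominator x q d k) (fun i => denominator (y i) (c i) d k).
Proof.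
move=> y0 hx hq; have hqd := specializesX d hq.
have hfactor (e : nat -> int) j := specializesM (specializesXz (e j) y0 hx) hqd.
apply: specializesM (specializes_qpoch k hqd hqd).
apply: specializesM.
  exact: (specializes_qpochs _ _ (hfactor (fun j => d%:Z - 2 - 2 * j%:Z)) hqd).
exact: (specializes_qpochs _ _ (hfactor (fun j => 2 - d%:Z + 2 * j%:Z)) hqd).
Qed.

Lemma specializes_qsum x q y c d n :
  (forall i, y i != 0) -> (forall i, 1 - c i != 0) -> (forall i, c i != 0) ->
  (forall k i, denominator (y i) (c i) d k != 0) ->
  specializes x y -> specializes q c ->
  specializes (qsum x q d n) (fun i => qsum (y i) (c i) d n).
Proof.
move=> y0 c1 c0 den0 hx hq.
rewrite /qsum; apply: (specializes_sum (index_iota 0 n) (g := fun k i =>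
    qint (c i) (2 * d * k + 1)%N%:Z
    * (numerator (y i) (c i) d k / denominator (y i) (c i) d k)
    * c i ^+ ((d * (d - 3) * k) %/ 2))) => k.
apply: specializesM (specializesX _ hq).
apply: specializesM.
  apply: (specializes_div c1) (specializesB specializes1 hq).
  exact: specializesB specializes1 (specializesXz _ c0 hq).
apply: (specializes_div (den0 k)); last exact: specializes_denominator.
exact: specializes_numerator.
Qed.
End Specialization.

(** * Vanishing of q-binomial moments *)
Section KarlssonMinton.
Variables (F : fieldType).
Implicit Types (x y p q : F).

Lemma qpochS x q k : qpoch x q k.+1 = qpoch x q k * (1 - x * q ^+ k).
Proof. by rewrite /qpoch big_ord_recr. Qed.

Lemma qpochD x q k l : qpoch x q (k + l) = qpoch x q k * qpoch (x * q ^+ k) q l.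
Proof.
elim: l => [|l IHl]; first by rewrite addn0 /qpoch big_ord0 mulr1.
by rewrite addnS !qpochS IHl -mulrA exprD -!mulrA.
Qed.

Lemma qpoch_neq0 x q k :
  (forall i, x * q ^+ i != 1) -> qpoch x q k != 0.
Proof.
by move=> hx; apply/prodf_neq0 => i _; rewrite subr_eq0 eq_sym hx.
Qed.

(** Both cross products equal (y; p)_(k+s), split after k or after s factors.
    The right-hand side depends on k through p^k only, polynomially. *)
Lemma qpoch_shift_ratio y p s k : (forall i, y * p ^+ i != 1) ->
  qpoch (y * p ^+ s) p k / qpoch y p k = qpoch (y * p ^+ k) p s / qpoch y p s.
Proof.
move=> hy; apply/eqP; rewrite eqr_div ?qpoch_neq0 //; apply/eqP.
by rewrite [LHS]mulrC -qpochD [RHS]mulrC -qpochD addnC.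
Qed.

Definition qpoch_poly y p s : {poly F} :=
  \prod_(i < s) (1 - (y * p ^+ i)%:P * 'X).

Lemma horner_qpoch_poly y p s z : (qpoch_poly y p s).[z] = qpoch (y * z) p s.
Proof.
rewrite /qpoch_poly horner_prod; apply: eq_bigr => i _.
by rewrite !hornerE mulrAC.
Qed.

Lemma size_prod_leq_const (I : Type) (r : seq I) (f : I -> {poly F}) s :
  (forall i, (size (f i) <= s.+1)%N) ->
  (size (\prod_(i <- r) f i)%R <= (size r * s).+1)%N.
Proof.
move=> hf; elim: r => [|i r IHr]; first by rewrite big_nil size_poly1.
rewrite big_cons; apply: leq_trans (size_polyMleq _ _) _.
by have /= := hf i; move: IHr => /=; lia.
Qed.

Lemma size_qpoch_poly y p s : (size (qpoch_poly y p s) <= s.+1)%N.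
Proof.
have := @size_prod_leq_const _ (enum 'I_s) (fun i => 1 - (y * p ^+ i)%:P * 'X) 1.
rewrite big_enum size_enum_ord muln1; apply=> i.
apply: leq_trans (size_polyD _ _) _; rewrite size_poly1 size_polyN geq_max /=.
apply: leq_trans (size_polyMleq _ _) _.
by rewrite size_polyX addn2 size_polyC; case: (_ != 0).
Qed.

Variable p : F.
Hypothesis p_neq0 : p != 0.
Hypothesis p_not_root_of_unity : forall m : nat, (0 < m)%N -> p ^+ m != 1.

(** Up to a sign and a power of p, the Gaussian binomial coefficient of N and k
    in base p. *)
Definition qbin_coef N k : F := qpoch (p ^- N) p k / qpoch p p k.

Lemma qbin_coefS N k :
  qbin_coef N k.+1 * (1 - p ^+ k.+1) = qbin_coef N k * (1 - p ^- N * p ^+ k).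
Proof.
have w0 : 1 - p ^+ k.+1 != 0 by rewrite subr_eq0 eq_sym p_not_root_of_unity.
rewrite /qbin_coef !qpochS -exprS invfM -!mulrA mulVf // mulr1.
by congr (_ * _); rewrite mulrC.
Qed.

Lemma qbin_coef_small N k : (N < k)%N -> qbin_coef N k = 0.
Proof.
move=> ltNk; rewrite /qbin_coef /qpoch (bigD1 (Ordinal ltNk)) //=.
by rewrite mulVf ?expf_neq0 // subrr !mul0r.
Qed.

(** Abel summation of the two-term recurrence [qbin_coefS]: the boundary terms
    vanish since 1 - p^0 = 0 at one end and the coefficients are zero beyond N at
    the other. *)
Lemma qbin_moment_rec N M s : (N < M)%N ->
  (1 - p ^+ s) * (\sum_(k < M) qbin_coef N k * (p ^+ k) ^+ s) =
  (1 - p ^- N * p ^+ s) * (\sum_(k < M) qbin_coef N k * (p ^+ k) ^+ s.+1).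
Proof.
move=> ltNM.
have tele : \sum_(k < M) qbin_coef N k * (1 - p ^+ k) * (p ^+ k) ^+ s =
   \sum_(k < M) qbin_coef N k.+1 * (1 - p ^+ k.+1) * (p ^+ k.+1) ^+ s.
  have := @big_ord_recr _ 0 +%R M (fun k => qbin_coef N k * (1 - p ^+ k) * (p ^+ k) ^+ s).
  rewrite /= qbin_coef_small // !mul0r addr0 => <-.
  by rewrite big_ord_recl /= expr0 subrr mulr0 mul0r add0r.
apply/eqP; rewrite -subr_eq0 !mulr_sumr -sumrB; apply/eqP.
transitivity (\sum_(k < M) (qbin_coef N k * (1 - p ^+ k) * (p ^+ k) ^+ s
   - qbin_coef N k.+1 * (1 - p ^+ k.+1) * (p ^+ k.+1) ^+ s)).
  by apply: eq_bigr => k _; rewrite qbin_coefS !exprS exprMn; ring.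
by rewrite sumrB tele subrr.
Qed.

(** In the recurrence the left factor kills the zeroth moment, whence the first
    moment is zero; the right factor is nonzero for s < N, which carries the
    vanishing up to the moment of order N. *)
Lemma qbin_moment_eq0 N M s : (N < M)%N -> (s < N)%N ->
  \sum_(k < M) qbin_coef N k * (p ^+ k) ^+ s.+1 = 0.
Proof.
move=> ltNM; have factor t : (t < N)%N -> 1 - p ^- N * p ^+ t != 0.
  move=> ltsN; rewrite subr_eq0 eq_sym; apply/negP => /eqP h.
  have /eqP[] : p ^+ (N - t) != 1 by rewrite p_not_root_of_unity ?subn_gt0.
  by rewrite expfB // -invf_div mulrC h invr1.
elim: s => [|s IHs] ltsN; apply: (mulfI (factor _ ltsN));
  rewrite mulr0 -qbin_moment_rec //.
  by rewrite expr0 subrr mul0r.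
by rewrite IHs ?mulr0 // ltnW.
Qed.

Lemma qbin_poly_sum_eq0 N M (Q : {poly F}) : (N < M)%N -> (size Q <= N)%N ->
  \sum_(k < M) qbin_coef N k * (p ^+ k * Q.[p ^+ k]) = 0.
Proof.
move=> ltNM leQN.
transitivity (\sum_(k < M) \sum_(i < size Q) Q`_i * (qbin_coef N k * (p ^+ k) ^+ i.+1)).
  apply: eq_bigr => k _; rewrite horner_coef !mulr_sumr; apply: eq_bigr => i _.
  by rewrite exprS; ring.
rewrite exchange_big big1 //= => i _.
by rewrite -mulr_sumr qbin_moment_eq0 ?mulr0 // (leq_trans _ leQN).
Qed.
End KarlssonMinton.

(** * Symmetry in a and 1/a *)

(** Inverting a exchanges the two lists of parameters with opposite exponents. *)
Lemma numeratorV (F : fieldType) (a q : F) d k :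
  numerator a^-1 q d k = numerator a q d k.
Proof.
rewrite /numerator; congr (_ * _); rewrite mulrC; congr (_ * _); congr (qpochs _ _ _);
  by apply: eq_map => j; rewrite exprz_inv; congr (_ ^ _ * _); ring.
Qed.

Lemma denominatorV (F : fieldType) (a q : F) d k :
  denominator a^-1 q d k = denominator a q d k.
Proof.
rewrite /denominator; congr (_ * _); rewrite mulrC; congr (_ * _); congr (qpochs _ _ _);
  by apply: eq_map => j; rewrite exprz_inv; congr (_ ^ _ * _); ring.
Qed.

Lemma qsumV (F : fieldType) (a q : F) d n : qsum a^-1 q d n = qsum a q d n.
Proof. by apply: eq_bigr => k _; rewrite numeratorV denominatorV. Qed.

(** * The sum at a root of the modulus *)
Section RootOfModulus.
Variables (F : fieldType) (q : F).
Hypothesis q_neq0 : q != 0.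
Hypothesis q_not_root_of_unity : forall m : nat, (0 < m)%N -> q ^+ m != 1.
Variables (h s : nat).
Hypothesis h_gt1 : (1 < h)%N.
Let d := h.*2.+1.
Let n := (d * s + h.*2)%N.
Let a := q ^+ n.
Let p := q ^+ d.

Lemma base_not_root_of_unity m : (0 < m)%N -> p ^+ m != 1.
Proof. by move=> m0; rewrite -exprM q_not_root_of_unity // muln_gt0. Qed.

Lemma exprz_neq1 z : z != 0 -> q ^ z != 1.
Proof.
case: z => m z0; first by rewrite q_not_root_of_unity // lt0n.
by rewrite NegzE -exprz_inv -exprnP exprVn invr_eq1 q_not_root_of_unity.
Qed.

Definition den_base (i : int) : F := a ^ i * q ^+ d.

Lemma den_baseE i l : den_base i * p ^+ l = q ^ (n%:Z * i + d%:Z + d%:Z * l%:Z).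
Proof. by rewrite !expfzDr // -!exprz_exp. Qed.

(** The exponent of q on the left is n i + d (l + 1) with i = 2w + 1 and
    n = -1 mod d.  If it were zero, d would divide i, which is odd and smaller
    than d in absolute value, so that i = 0, contradicting its parity. *)
Lemma den_base_neq1 (w : int) l : (`|(2 * w + 1)%R| < d)%N ->
  den_base (2 * w + 1) * p ^+ l != 1.
Proof.
move=> ltwd; rewrite den_baseE; apply: exprz_neq1; apply/negP => /eqP.
(* Forgetting h keeps only n = d s + (d - 1) and the parity of d. *)
rewrite /n; have -> : h.*2 = d.-1 by [].
have d_gt0 : (0 < d)%N by [].
have d_odd : d = h.*2.+1 by [].
move: d d_odd d_gt0 ltwd => e e_odd e_gt0 ltwe.
rewrite PoszD PoszM predn_int // => e0.
have e1 : e%:Z * ((2 * w + 1) * s%:Z + (2 * w + 1) + 1 + l%:Z) = 2 * w + 1.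
  by rewrite -[RHS]addr0 -e0; ring.
move: e1; set t := (X in e%:Z * X) => e1.
case: (t =P 0) => [t0|t0]; first by move: e1; rewrite t0 mulr0; lia.
by move: ltwe; rewrite -e1 abszM ltnNge leq_pmulr // absz_gt0; apply/eqP.
Qed.

(** The key matching: n + 1 = d (s + 1) makes a q equal to p^s q^d at a = q^n. *)
Lemma den_base_shift i : a ^ (i + 1) * q = den_base i * p ^+ s.
Proof.
rewrite den_baseE /a -[in LHS](expr1z q) exprnP exprz_exp -expfzDr //; congr (q ^ _).
by rewrite /n /d; lia.
Qed.

Definition ratio_poly y : {poly F} := (qpoch y p s)^-1 *: qpoch_poly y p s.

Lemma horner_ratio_poly y k : (forall l, y * p ^+ l != 1) ->
  (ratio_poly y).[p ^+ k] = qpoch (y * p ^+ s) p k / qpoch y p k.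
Proof.
by move=> hy; rewrite hornerZ horner_qpoch_poly qpoch_shift_ratio // mulrC.
Qed.

Lemma size_ratio_poly y : (size (ratio_poly y) <= s.+1)%N.
Proof. exact: leq_trans (size_scale_leq _ _) (size_qpoch_poly _ _ _). Qed.

Let pos_exp (j : nat) : int := d%:Z - 2 - 2 * j%:Z.
Let neg_exp (j : nat) : int := 2 - d%:Z + 2 * j%:Z.
Let N := (d.-1 * s + d.-2)%N.

(** This factor makes the sum terminate: here d (d-1) (s+1) - d = d N. *)
Lemma extreme_factorE : a ^ (1 - d%:Z) * q = p ^- N.
Proof.
rewrite /a /p -exprM exprnN exprnP exprz_exp -[q in X in _ * X](expr1z q) -expfzDr //.
by congr (q ^ _); rewrite /n /N /d; nia.
Qed.

Lemma denominator_qXn_neq0 k : denominator a q d k != 0.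
Proof.
have hl : d./2 = h by rewrite /d /= uphalf_double.
rewrite /denominator hl /qpochs !big_map !mulf_neq0 //.
- rewrite prodf_seq_neq0; apply/allP => j; rewrite mem_iota => /andP[_ ltj] /=.
  apply: qpoch_neq0 => l; have := @den_base_neq1 (h%:Z - 1 - j%:Z) l.
  rewrite /den_base (_ : 2 * _ + 1 = d%:Z - 2 - 2 * j%:Z); last by rewrite /d; lia.
  by apply; rewrite /d; lia.
- rewrite prodf_seq_neq0; apply/allP => j; rewrite mem_iota => /andP[_ ltj] /=.
  apply: qpoch_neq0 => l; have := @den_base_neq1 (- h%:Z + j%:Z) l.
  rewrite /den_base (_ : 2 * _ + 1 = 2 - d%:Z + 2 * j%:Z); last by rewrite /d; lia.
  by apply; rewrite /d; lia.
by apply: qpoch_neq0 => l; rewrite -exprS base_not_root_of_unity.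
Qed.

(** The exponents 1-d, 3-d, ..., -2, together with the exponent 0 of the single
    factor (q; p)_k, form one progression.  Its first term is the factor of
    [extreme_factorE]; the others lie one above 2-d, 4-d, ..., -1. *)
Lemma numerator_neg_part k :
  (\prod_(j <- iota 0 h) qpoch (a ^ (1 - d%:Z + 2 * j%:Z) * q) p k) * qpoch q p k =
  qpoch (p ^- N) p k * \prod_(j <- iota 0 h) qpoch (den_base (neg_exp j) * p ^+ s) p k.
Proof.
(* The factor with exponent 0 is the term of index h of the progression. *)
pose f j := qpoch (a ^ (1 - d%:Z + 2 * j%:Z) * q) p k.
have -> : qpoch q p k = f h.
  by rewrite /f (_ : 1 - d%:Z + 2 * h%:Z = 0) ?expr0z ?mul1r // /d; lia.
have -> : qpoch (p ^- N) p k = f 0 by rewrite /f mulr0 addr0 extreme_factorE.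
have -> : iota 0 h = index_iota 0 h by rewrite /index_iota subn0.
rewrite -(big_nat_recr h 0 f) // big_nat_recl //; congr (_ * _).
apply: eq_bigr => j _; rewrite /f -den_base_shift /neg_exp; congr (qpoch (_ ^ _ * _) _ _).
by lia.
Qed.

Lemma summand_qbin_coef k :
  numerator a q d k / denominator a q d k =
  qbin_coef p N k
  * (\prod_(j <- iota 0 h) (ratio_poly (den_base (pos_exp j))).[p ^+ k]
     * \prod_(j <- iota 0 h) (ratio_poly (den_base (neg_exp j))).[p ^+ k]).
Proof.
have hl : d./2 = h by rewrite /d /= uphalf_double.
have -> : \prod_(j <- iota 0 h) (ratio_poly (den_base (pos_exp j))).[p ^+ k] =
  (\prod_(j <- iota 0 h) qpoch (den_base (pos_exp j) * p ^+ s) p k) /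
  \prod_(j <- iota 0 h) qpoch (den_base (pos_exp j)) p k.
  rewrite -prodf_div; apply: eq_big_seq => j; rewrite mem_iota => /andP[_ ltj].
  apply: horner_ratio_poly => l.
  rewrite (_ : pos_exp j = 2 * (h%:Z - 1 - j%:Z) + 1); last by rewrite /pos_exp /d; lia.
  by apply: den_base_neq1; rewrite /d; lia.
have -> : \prod_(j <- iota 0 h) (ratio_poly (den_base (neg_exp j))).[p ^+ k] =
  (\prod_(j <- iota 0 h) qpoch (den_base (neg_exp j) * p ^+ s) p k) /
  \prod_(j <- iota 0 h) qpoch (den_base (neg_exp j)) p k.
  rewrite -prodf_div; apply: eq_big_seq => j; rewrite mem_iota => /andP[_ ltj].
  apply: horner_ratio_poly => l.
  rewrite (_ : neg_exp j = 2 * (- h%:Z + j%:Z) + 1); last by rewrite /neg_exp /d; lia.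
  by apply: den_base_neq1; rewrite /d; lia.
rewrite /numerator /denominator hl /qpochs !big_map -mulrA numerator_neg_part -/p.
rewrite /qbin_coef !mulf_div; congr (_ / _); last by rewrite mulrC.
rewrite mulrCA; congr (_ * (_ * _)); apply: eq_bigr => j _.
by rewrite -den_base_shift /pos_exp; congr (qpoch (_ ^ _ * _) _ _); lia.
Qed.

(** Everything but the q-binomial coefficient and one factor p^k is a polynomial
    in p^k of size at most 3 + (h - 2) + 2hs = 2hs + h + 1, which is at most
    N = 2hs + 2h - 1 exactly when h >= 2, that is, when d >= 5. *)
Lemma qsum_qXn_eq0 : qsum a q d n = 0.
Proof.
pose Q : {poly F} := (1 - q) ^-1 *: ((1 - q%:P * 'X^2) * 'X^(h.-2)
   * (\prod_(j <- iota 0 h) ratio_poly (den_base (pos_exp j))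
      * \prod_(j <- iota 0 h) ratio_poly (den_base (neg_exp j)))).
rewrite -(@qbin_poly_sum_eq0 F p _ base_not_root_of_unity N n Q).
- rewrite /qsum big_mkord; apply: eq_bigr => k _.
  rewrite summand_qbin_coef /Q hornerZ !hornerM !horner_prod.
  rewrite hornerD hornerN hornerM !hornerXn !hornerC.
  have -> : qint q (2 * d * k + 1)%N = (1 - q * (p ^+ k) ^+ 2) / (1 - q).
    rewrite /qint -exprnP /p -!exprM -exprS; congr ((1 - q ^+ _) / _); lia.
  have -> : q ^+ ((d * (d - 3) * k) %/ 2) = p ^+ k * (p ^+ k) ^+ h.-2.
    rewrite -exprS /p -!exprM; congr (q ^+ _).
    have -> : (d * (d - 3) * k = (d * (k * h.-2.+1)) * 2)%N.
      by rewrite /d; case: (h) h_gt1 => [|[|h']] // _; rewrite /=; nia.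
    by rewrite mulnK // mulnA.
  ring.
- by rewrite expf_neq0.
- by rewrite /N /n /d; lia.
apply: leq_trans (size_scale_leq _ _) _.
have szprod e := @size_prod_leq_const F _ (iota 0 h)
  (fun j => ratio_poly (den_base (e j))) s (fun j => size_ratio_poly _).
apply: leq_trans (size_polyMleq _ _) _.
have h1 : (size (1 - q%:P * 'X^2 : {poly F})%R <= 3)%N.
  apply: leq_trans (size_polyD _ _) _; rewrite size_poly1 size_polyN geq_max /=.
  apply: leq_trans (size_polyMleq _ _) _.
  by rewrite size_polyXn size_polyC; case: (_ != 0).
have h2 := size_polyMleq (1 - q%:P * 'X^2 : {poly F}) 'X^(h.-2).
have h3 := size_polyMleq (\prod_(j <- iota 0 h) ratio_poly (den_base (pos_exp j)))
   (\prod_(j <- iota 0 h) ratio_poly (den_base (neg_exp j))).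
have := szprod pos_exp; have := szprod neg_exp; rewrite size_iota.
rewrite size_polyXn in h2.
move: h1 h2 h3; rewrite /N /d /=.
move: (size _) (size _) (size _) (size _) (size _) => x1 x2 x3 x4 x5.
nia.
Qed.
End RootOfModulus.

(** * Evaluation at the roots of the modulus *)
Local Notation Qq := {fraction {poly rat}}.

Definition qfrac : Qq := tofrac 'X.

Lemma qfrac_neq0 : qfrac != 0.
Proof. by rewrite tofrac_eq0 polyX_eq0. Qed.

Lemma qfrac_not_root_of_unity m : (0 < m)%N -> qfrac ^+ m != 1.
Proof.
move=> m_gt0; rewrite -tofracXn -tofrac1 tofrac_eq; apply/eqP.
move=> /(congr1 (size : {poly rat} -> nat)).
by rewrite size_polyXn size_poly1 => -[] m0; rewrite m0 in m_gt0.
Qed.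

Definition eval_a (c : Qq) : {rmorphism Qaq -> Qq} :=
  (horner_eval c \o map_poly (@tofrac {poly rat})).

Lemma eval_aE c W : eval_a c W = (map_poly (@tofrac {poly rat}) W).[c].
Proof. by []. Qed.

Lemma eval_a_pa c : eval_a c pa = c.
Proof. by rewrite eval_aE map_polyX hornerX. Qed.

Lemma eval_a_pq c : eval_a c pq = qfrac.
Proof. by rewrite eval_aE map_polyC hornerC. Qed.

Section Modulus.
Variable n : nat.
Hypothesis hn : (0 < n)%N.

Definition mod_root (b : bool) : Qq := if b then qfrac ^+ n else qfrac ^- n.
Definition eval_root b := eval_a (mod_root b).
Definition modulus : Qaq := (1 - pa * pq ^+ n) * (pa - pq ^+ n).

Lemma mod_root_neq : mod_root true != mod_root false.
Proof.
apply/eqP => h; have := qfrac_not_root_of_unity (m := (n + n)%N).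
rewrite addn_gt0 hn => /(_ isT)/eqP; apply.
by rewrite exprD {1}[qfrac ^+ n]h mulVf ?expf_neq0 ?qfrac_neq0.
Qed.

(** Coefficients by increasing powers of a; the outer ones are coprime to the
    middle one in Q[q]. *)
Lemma modulus_polyseq : modulus = [:: - 'X^n; 1 + 'X^(n + n); - 'X^n] :> seq {poly rat}.
Proof.
suff ->: modulus = Poly [:: - 'X^n; 1 + 'X^(n + n); - 'X^n].
  by rewrite (PolyK (c := 0)) //= oppr_eq0 monic_neq0 ?monicXn.
rewrite /= !cons_poly_def /modulus /pa /pq mul0r add0r.
rewrite -polyC_exp polyCD exprD polyCM polyC1 polyCN.
by move: (_ %:P) => u; ring.
Qed.

Lemma eval_modulus b : eval_root b modulus = 0.
Proof.
rewrite rmorphM !rmorphB rmorph1 rmorphM !rmorphXn /eval_root !eval_a_pa !eval_a_pq.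
case: b; rewrite /mod_root ?subrr ?mulr0 //.
by rewrite mulVf ?expf_neq0 ?qfrac_neq0 // subrr mul0r.
Qed.

Lemma size_gt2_of_roots (W : Qaq) :
  W != 0 -> (forall b, eval_root b W = 0) -> (2 < size W)%N.
Proof.
move=> W0 h; set W' := map_poly (@tofrac {poly rat}) W.
have eW : size W' = size W.
  by apply: size_map_inj_poly; [| exact: tofrac0] => x y /eqP; rewrite tofrac_eq => /eqP.
rewrite -eW; apply: (@max_poly_roots _ W' [:: mod_root true; mod_root false]).
- by rewrite -size_poly_gt0 eW size_poly_gt0.
- have hW b : root W' (mod_root b) by apply/eqP; exact: h.
  by apply/allP => c; rewrite !inE => /orP[]/eqP->.
- by rewrite /= inE mod_root_neq.
Qed.

Lemma size_modulus : size modulus = 3%N.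
Proof. by rewrite modulus_polyseq. Qed.

Lemma lead_coef_modulus : lead_coef modulus = - 'X^n.
Proof. by rewrite lead_coefE modulus_polyseq. Qed.

(** A common divisor c is nonzero at both roots, so its cofactor P' in the
    modulus has both of them and takes up the whole degree in a.  Thus c lies in
    Q[q] and divides the coefficients -q^n and 1 + q^(2n), which generate the
    unit ideal: 1 = (1 + q^(2n)) - (q^n)^2. *)
Lemma modulus_relatively_prime (V : Qaq) :
  (forall b, eval_root b V != 0) -> relatively_prime V modulus.
Proof.
move=> hV c V' P' eV eP.
have modulus_neq0 : modulus != 0 by rewrite -size_poly_gt0 size_modulus.
have hP' b : eval_root b P' = 0.
  have /eqP := eval_modulus b; have := hV b; rewrite eV eP !rmorphM !mulf_eq0 negb_or.
  by case/andP=> /negPf -> _ /= /eqP.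
move: modulus_neq0; rewrite eP mulf_eq0 negb_or => /andP[c0 P'0].
have := size_gt2_of_roots P'0 hP'; have := size_modulus; rewrite eP size_mul // => sc sP'.
have /size_poly1P : size c == 1%N.
  move: c0 sc sP'; rewrite -size_poly_gt0.
  by move: (size c) (size P') => m1 m2; lia.
case=> r _ er; have coef_modulus i : modulus`_i = r * P'`_i by rewrite eP er coefCM.
have := coef_modulus 0; have := coef_modulus 1; rewrite modulus_polyseq /= => e1 e0.
apply/unitrPr; exists (P'`_1 - r * P'`_0 ^+ 2)%:P.
rewrite er -polyCM mulrBr -e1 mulrA -expr2 -exprMn -e0 sqrrN expr2 -exprD.
by rewrite addrK.
Qed.

(** Pseudo-division of U by the modulus, with multiplier a power of its leading
    coefficient -q^n; the multiplier is moved to the denominator, where it is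
    harmless as it vanishes at neither root. *)
Lemma specializes_congr0 (x : Qaq_frac) :
  specializes eval_root x (fun=> 0) -> frac_congr0 modulus x.
Proof.
move=> [U [V [hV -> hU]]].
have {}hU b : eval_root b U = 0.
  by have /eqP := hU b; rewrite eq_sym mulf_eq0 invr_eq0 (negPf (hV b)) orbF => /eqP.
set L : Qaq := (lead_coef modulus ^+ scalp U modulus)%:P.
have hL b : eval_root b L != 0.
  rewrite /eval_root eval_aE map_polyC hornerC tofrac_eq0 expf_neq0 //.
  by rewrite lead_coef_modulus oppr_eq0 monic_neq0 ?monicXn.
have modulus_neq0 : modulus != 0 by rewrite -size_poly_gt0 size_modulus.
have eLU : L * U = modulus * (U %/ modulus).
  have := Pdiv.Idomain.divp_eq U modulus; rewrite -mul_polyC -/L => eLU.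
  suff modU0 : U %% modulus = 0 by rewrite eLU modU0 addr0 mulrC.
  apply/eqP/negPn/negP => mod_neq0; have := ltn_modp U modulus.
  rewrite modulus_neq0 size_modulus.
  rewrite ltnNge size_gt2_of_roots // => b.
  have /(congr1 (eval_root b)) := eLU.
  rewrite rmorphD !(rmorphM _ _ U) (rmorphM _ _ modulus) hU eval_modulus.
  by rewrite !mulr0 add0r.
exists (U %/ modulus), (L * V).
have hLV b : eval_root b (L * V) != 0 by rewrite rmorphM mulf_neq0.
split; last 1 first.
- rewrite -eLU !tofracM -mulf_div divff ?mul1r // tofrac_eq0.
  by apply: contraNneq (hL true) => ->; rewrite rmorph0.
- by apply: contraNneq (hLV true) => ->; rewrite rmorph0.
exact: modulus_relatively_prime.
Qed.
End Modulus.

(** * The congruence *)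
Theorem theorem5 (d n : nat) (hd5 : (5 <= d)%N) (hdodd : odd d)
  (hn : (0 < n)%N) (hnd : (n%:Z = -1 %[mod d%:Z])%Z) :
  frac_congr0 ((1 - pa * pq ^+ n) * (pa - pq ^+ n)) (qsum fa fq d n).
Proof.
have [h h_gt1 ed] : exists2 h, (1 < h)%N & d = h.*2.+1.
  by exists d./2; move: (odd_double_half d); rewrite hdodd; lia.
have [s en] : exists s, n = (d * s + h.*2)%N.
  move/eqP: hnd; rewrite eqz_mod_dvd opprK -PoszD addn1 => /dvdnP[m em].
  exists m.-1.
  by case: m em => [|m]; rewrite ?ed //=; nia.
apply: (specializes_congr0 hn).
have q0 := qfrac_neq0; have qroot := qfrac_not_root_of_unity.
have root_neq0 b : mod_root n b != 0.
  by case: b; rewrite /mod_root ?invr_eq0 expf_neq0.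
have ha : specializes (eval_root n) fa (mod_root n).
  by apply: eq_specializes (specializes_tofrac (eval_root n) pa) => b; apply: eval_a_pa.
have hq : specializes (eval_root n) fq (fun=> qfrac).
  by apply: eq_specializes (specializes_tofrac (eval_root n) pq) => b; apply: eval_a_pq.
apply: eq_specializes (specializes_qsum true n root_neq0 _ _ _ ha hq)
  => [b||//|k b] /=.
- case: b; rewrite /mod_root ?qsumV en ed; exact: qsum_qXn_eq0.
- by move=> _; rewrite subr_eq0 eq_sym -[qfrac]expr1 qroot.
- case: b; rewrite /mod_root ?denominatorV en ed; exact: denominator_qXn_neq0.
Qed.
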